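(* Let $\Sigma$ be a finite alphabet and let $X \subset \Sigma^{\mathbb{Z}}$ be a subshift. The following are equivalent: (a) $X$ has a $g$-function. (b) $X$ has property $g$, i.e. $\Delta_1^+(x^-) \neq \emptyset$ for all $x^- \in X_{(-\infty,0]}$. (c) $X$ has a strict $g$-function.
   Context: $\Sigma$ is a finite alphabet; a subshift $X\subset\Sigma^{\mathbb Z}$ is a closed shift-invariant set. For $x\in X$ and an interval of integers $I$ (finite or infinite), $x_I=(x_j)_{j\in I}$, and $X_I=\{x_I: x\in X\}$; $X_I$ carries the topology inherited from the product topology on $\Sigma^I$ ($\Sigma$ discrete). Juxtaposition or pairs such as $(x^-,b)$ denote concatenation. For $x^-\in X_{(-\infty,0]}$: $\Gamma_1^+(x^-)=\{\sigma\in\Sigma: (x^-,\sigma)\in X_{(-\infty,1]}\}$. For a word $a\in X_{(-k,0]}$: $\Gamma_\infty^-(a)$ is the set of left-infinite sequences $y^-\in X_{(-\infty,-k]}$ with $(y^-,a)\in X_{(-\infty,0]}$, and $\omega_1^+(a)=\{\sigma\in\Sigma : (y^-,a,\sigma)\in X_{(-\infty,1]}\text{ for all } y^-\in\Gamma_\infty^-(a)\}$. For $x^-\in X_{(-\infty,0]}$: $\Delta_1^+(x^-)=\bigcup_{n\in\mathbb N}\omega_1^+(x^-_{[-n,0]})$. A $g$-function for $X$ is a continuous mapping $g:\{(x^-,\sigma)\in X_{(-\infty,0]}\times\Sigma:\sigma\in\Gamma_1^+(x^-)\}\to[0,1]$ such that $\sum_{\alpha\in\Gamma_1^+(x^-)}g(x^-,\alpha)=1$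 for all $x^-\in X_{(-\infty,0]}$. A $g$-function is strict if $g(x^-,\alpha)>0$ for all $x^-\in X_{(-\infty,0]}$ and $\alpha\in\Delta_1^+(x^-)$. *)

(* Defs.v *)
From HB Require Import structures.
From mathcomp Require Import all_boot all_order all_algebra.
From mathcomp Require Import all_classical all_reals all_analysis.

Import Order.TTheory GRing.Theory Num.Theory.
Import numFieldNormedType.Exports.

Local Open Scope classical_set_scope.
Local Open Scope ring_scope.

Definition bisequence (Sigma : finType) : Type :=
  {ptws int -> discrete_topology Sigma}.

HB.instance Definition _ (Sigma : finType) :=
  Topological.copy (bisequence Sigma) {ptws int -> discrete_topology Sigma}.

Definition shift_map {Sigma : finType} (x : bisequence Sigma) :
  bisequence Sigma := fun i => x (i + 1).

Definition subshift {Sigma : finType} (X : set (bisequence Sigma)) : Prop :=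
  closed X /\ shift_map @` X = X.

(* Sigma^I for a finite or infinite interval of integers I. *)
Definition block (Sigma : finType) (I : interval int) : Type :=
  {ptws {i : int | i \in I} -> discrete_topology Sigma}.

HB.instance Definition _ (Sigma : finType) (I : interval int) :=
  Topological.copy (block Sigma I)
    {ptws {i : int | i \in I} -> discrete_topology Sigma}.

Definition restr {Sigma : finType} (I : interval int) (x : bisequence Sigma) :
  block Sigma I := fun i => x (val i).

Definition blocks {Sigma : finType} (X : set (bisequence Sigma))
  (I : interval int) : set (block Sigma I) := [set restr I x | x in X].

Definition subblock {Sigma : finType} {I J : interval int}
    (JI : {subset J <= I}) (x : block Sigma I) : block Sigma J :=
  fun j => x (exist _ (val j) (JI _ (valP j))).

Lemma in_itv_concat {b1 b2 b3 : itv_bound int} {i : int} :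
  i \in Interval b1 b3 -> i \notin Interval b1 b2 -> i \in Interval b2 b3.
Proof.
rewrite !itv_boundlr => /andP[-> ->]; rewrite andbT /= -ltNge => b2i.
by move: b2i; case: b2 => [[] y|[]] //; rewrite !bnd_simp // => /ltW.
Qed.

(* Concatenation of blocks over two adjacent intervals, the first ending at
   the bound b2 where the second starts. *)
Definition concat {Sigma : finType} {b1 b2 b3 : itv_bound int}
    (u : block Sigma (Interval b1 b2)) (v : block Sigma (Interval b2 b3)) :
    block Sigma (Interval b1 b3) :=
  fun i => match boolP (val i \in Interval b1 b2) with
    | AltTrue h => u (exist _ (val i) h)
    | AltFalse h => v (exist _ (val i) (in_itv_concat (valP i) h))
    end.

(* The symbol sigma, placed at coordinate 1. *)
Definition letter {Sigma : finType} (sigma : Sigma) :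
  block Sigma `]0, 1] := fun=> sigma.

Definition Gamma1p {Sigma : finType} (X : set (bisequence Sigma))
    (x : block Sigma `]-oo, 0]) : set Sigma :=
  [set sigma | blocks X `]-oo, 1] (concat x (letter sigma))].

Definition Gammainfm {Sigma : finType} (X : set (bisequence Sigma)) {k : nat}
    (a : block Sigma `](- k%:Z), 0]) : set (block Sigma `]-oo, (- k%:Z)]) :=
  [set y | blocks X `]-oo, (- k%:Z)] y /\ blocks X `]-oo, 0] (concat y a)].

(* Intended for a in blocks X `](- k%:Z), 0]; for other words Gammainfm X a is
   empty and the condition is vacuous. *)
Definition omega1p {Sigma : finType} (X : set (bisequence Sigma)) {k : nat}
    (a : block Sigma `](- k%:Z), 0]) : set Sigma :=
  [set sigma | forall y, Gammainfm X a y ->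
     blocks X `]-oo, 1] (concat (concat y a) (letter sigma))].

Lemma subset_past (k : nat) :
  {subset `](- k%:Z), 0] <= (`]-oo, 0] : interval int)}.
Proof. exact: subset_itv. Qed.

(* The integer interval [-n, 0] is written ]-(n+1), 0]. *)
Definition Delta1p {Sigma : finType} (X : set (bisequence Sigma))
    (x : block Sigma `]-oo, 0]) : set Sigma :=
  \bigcup_(n : nat) omega1p X (subblock (subset_past n.+1) x).

Definition gdom {Sigma : finType} (X : set (bisequence Sigma)) :
    set (block Sigma `]-oo, 0] * discrete_topology Sigma) :=
  [set p | blocks X `]-oo, 0] p.1 /\ Gamma1p X p.1 p.2].

(* g is given as a total function; only its values on gdom X matter. *)
Definition g_function {R : realType} {Sigma : finType}
    (X : set (bisequence Sigma))
    (g : block Sigma `]-oo, 0] * discrete_topology Sigma -> R) : Prop :=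
  [/\ {within gdom X, continuous g},
      forall p, gdom X p -> 0 <= g p <= 1
    & forall x, blocks X `]-oo, 0] x ->
        \sum_(alpha : Sigma | alpha \in Gamma1p X x) g (x, alpha) = 1].

Definition strict_g_function {R : realType} {Sigma : finType}
    (X : set (bisequence Sigma))
    (g : block Sigma `]-oo, 0] * discrete_topology Sigma -> R) : Prop :=
  g_function X g /\
  forall x alpha, blocks X `]-oo, 0] x -> Delta1p X x alpha ->
    0 < g (x, alpha).

Definition property_g {Sigma : finType} (X : set (bisequence Sigma)) : Prop :=
  forall x, blocks X `]-oo, 0] x -> Delta1p X x !=set0.

(* Main.v *)
Require Import Defs.
From mathcomp Require Import all_boot all_order all_algebra.
From mathcomp Require Import all_classical all_reals all_analysis.

Import Order.TTheory GRing.Theory Num.Theory.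
Import numFieldNormedType.Exports.

Local Open Scope classical_set_scope.
Local Open Scope ring_scope.

(* From a g-function g: if g (x, alpha) > 0 but alpha is not in Delta1p X x,
   there are admissible y_n -> x for which alpha is not in Gamma1p X y_n. As
   Gamma1p has closed graph and g is continuous, the sums of g (y_n, .) are
   eventually at most 1 - g (x, alpha) + o(1), a contradiction; so Delta1p X x
   contains every symbol that g charges at x. Conversely, weigh sigma at x by
   1 / (n + 1) for the least n with sigma in omega1p of x on [-n, 0], and by 0
   if there is none. The weight is continuous in x, positive exactly on
   Delta1p X x, and property g allows normalising it. *)

(** * Topology of block spaces: coordinatewise convergence and compactness *)

Lemma near_ptws_discrete {I : eqType} {S : choiceType}
    (f : {ptws I -> discrete_topology S}) (i : I) :
  \forall g \near f, g i = f i.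
Proof.
have /(_ [set f i]) := @proj_continuous I (fun=> discrete_topology S) i f.
by apply; exact: discrete_set1.
Qed.

(** The product topology is the supremum of the topologies pulled back along the projections, and
    converging in a discrete factor means being eventually equal to the limit. *)
Lemma cvg_ptws_discrete {I : eqType} {S : choiceType} {T : Type}
    {F : set_system T} {FF : Filter F}
    (u : T -> {ptws I -> discrete_topology S})
    (f : {ptws I -> discrete_topology S}) :
  (forall i, \forall t \near F, u t i = f i) -> u @ F --> f.
Proof.
move=> uf; have uFF : Filter (u @ F) := fmap_filter u FF.
apply/cvg_sup => i A [B [[C oC <-] Cf BA]].
rewrite nbhs_simpl; apply: filterS (uf i) => t ti; apply: BA.
by rewrite /= /proj ti.
Qed.

Lemma cvg_block {Sigma : finType} {I : interval int} {T : Type}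
    {F : set_system T} {FF : Filter F} (u : T -> block Sigma I)
    (f : block Sigma I) :
  (forall i, \forall t \near F, u t i = f i) -> u @ F --> f.
Proof. exact: (@cvg_ptws_discrete {i : int | i \in I} Sigma). Qed.

Lemma near_block {Sigma : finType} {I : interval int} (f : block Sigma I) i :
  \forall g \near f, g i = f i.
Proof. exact: (@near_ptws_discrete {i : int | i \in I} Sigma). Qed.

Lemma near_bisequence {Sigma : finType} (f : bisequence Sigma) (i : int) :
  \forall g \near f, g i = f i.
Proof. exact: (@near_ptws_discrete int Sigma). Qed.

Lemma block_continuous {Sigma : finType} {I : interval int}
    {T : topologicalType} (f : T -> block Sigma I) :
  (forall x i, \forall y \near x, f y i = f x i) -> continuous f.
Proof. by move=> fx x; exact (cvg_block f (f x) (fx x)). Qed.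

Lemma bisequence_compact (Sigma : finType) :
  compact [set: bisequence Sigma].
Proof.
have fS : finite_set [set: discrete_topology Sigma].
  exact: (@finite_finset Sigma setT).
have := @tychonoff int _ _ (fun=> finite_compact fS).
by congr compact; rewrite eqEsubset.
Qed.

Lemma block_hausdorff (Sigma : finType) (I : interval int) :
  hausdorff_space (block Sigma I).
Proof.
apply: (@hausdorff_product _ (fun=> discrete_topology Sigma)) => i.
exact: discrete_hausdorff.
Qed.

Lemma restr_continuous {Sigma : finType} (I : interval int) :
  continuous (@restr Sigma I).
Proof.
by apply: block_continuous => x i; exact (near_bisequence x (val i)).
Qed.

(** Projections need not preserve closed sets; here [X] is compact because the alphabet is finite,
    and its continuous image is compact in a Hausdorff space. *)
Lemma blocks_closed {Sigma : finType} (X : set (bisequence Sigma)) I :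
  closed X -> closed (blocks X I).
Proof.
move=> cX; apply: compact_closed; first exact: block_hausdorff.
apply: continuous_compact; first exact/continuous_subspaceT/restr_continuous.
exact: subclosed_compact (bisequence_compact Sigma) (@subsetT _ X).
Qed.

(** * Concatenation and restriction of blocks *)

Lemma concat_inl {Sigma : finType} {b1 b2 b3 : itv_bound int}
    (u : block Sigma (Interval b1 b2)) (v : block Sigma (Interval b2 b3))
    {i : {i | i \in Interval b1 b3}}
    (hi : val i \in Interval b1 b2) :
  concat u v i = u (exist _ (val i) hi).
Proof.
rewrite /concat.
(* [case: boolP] would also abstract the boolean on which [u] and [v] depend. *)
refine (match boolP (val i \in Interval b1 b2) as d in alt_spec _ _ b return
  match d with AltTrue h => _ | AltFalse h => _ end = _ with
  AltTrue h => _ | AltFalse h => _ end).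
  by congr u; exact: val_inj.
by exfalso; rewrite hi in h.
Qed.

Lemma concat_inr {Sigma : finType} {b1 b2 b3 : itv_bound int}
    (u : block Sigma (Interval b1 b2)) (v : block Sigma (Interval b2 b3))
    {i : {i | i \in Interval b1 b3}}
    (hi : val i \notin Interval b1 b2) :
  concat u v i = v (exist _ (val i) (in_itv_concat (valP i) hi)).
Proof.
rewrite /concat.
refine (match boolP (val i \in Interval b1 b2) as d in alt_spec _ _ b return
  match d with AltTrue h => _ | AltFalse h => _ end = _ with
  AltTrue h => _ | AltFalse h => _ end).
  by exfalso; rewrite h in hi.
by congr v; exact: val_inj.
Qed.

Lemma concat_continuous {Sigma : finType} {b1 b2 b3 : itv_bound int}
    (v : block Sigma (Interval b2 b3)) :
  continuous (fun u : block Sigma (Interval b1 b2) => concat u v).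
Proof.
apply: block_continuous => u i.
have [h|h] := boolP (val i \in Interval b1 b2).
  apply: filterS (near_block u (exist _ (val i) h)) => w wu.
  by rewrite !(concat_inl _ _ h).
by apply: (@filterE _ (nbhs u)) => w; rewrite !(concat_inr _ _ h).
Qed.

(** Preimage of the closed set [blocks X] over []-oo, 1]] under the continuous map that appends
    [sigma]. *)
Lemma Gamma1p_closed {Sigma : finType} (X : set (bisequence Sigma)) sigma :
  closed X -> closed [set x | Gamma1p X x sigma].
Proof.
move=> cX; apply: closed_comp (blocks_closed X `]-oo, 1] cX) => x _.
exact: concat_continuous.
Qed.

(** The interval consists of the [n] points [- k] with [k < n], so finitely many coordinate
    neighbourhoods of [x] are intersected. *)
Lemma near_subblock {Sigma : finType} (n : nat) (x : block Sigma `]-oo, 0]) :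
  \forall y \near x, subblock (subset_past n) y = subblock (subset_past n) x.
Proof.
pose P (k : 'I_n) := [set y : block Sigma `]-oo, 0] | forall h,
  y (exist _ (- (k : nat)%:Z) h) = x (exist _ (- (k : nat)%:Z) h)].
have : nbhs x [set y | forall k, P k y].
  apply: (@filter_forall _ _ P (nbhs x) (nbhs_filter x)) => k.
  have h : - (k : nat)%:Z \in (`]-oo, 0] : interval int).
    by rewrite in_itv /= oppr_le0.
  apply: filterS (near_block x (exist _ (- (k : nat)%:Z) h)) => y yx h'.
  by rewrite (bool_irrelevance h' h).
apply: filterS => y yx; apply: funext => -[i hi]; rewrite /subblock /=.
have: i \in (`]-oo, 0] : interval int) by exact: (subset_past n).
set h := (subset_past _ _ _); move: h => h _.
have [k ki] : exists k : 'I_n, i = - (k : nat)%:Z.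
  move: hi; rewrite in_itv /= => /andP[i1 i2].
  have kn : (`|i| < n)%N by rewrite -ltz_nat abszE ler0_norm // ltrNl.
  by exists (Ordinal kn); rewrite /= abszE ler0_norm // opprK.
by subst i; exact: yx.
Qed.

(** A coordinate [i <= 0] lies in the window of agreement as soon as [|i| < n], so it is eventually
    constant along [u]. *)
Lemma subblock_cvg {Sigma : finType} (u : nat -> block Sigma `]-oo, 0])
    (x : block Sigma `]-oo, 0]) :
  (forall n,
    subblock (subset_past n.+1) (u n) = subblock (subset_past n.+1) x) ->
  u @ \oo --> x.
Proof.
move=> ux; refine (cvg_block u x _) => -[i hi].
near=> n.
have hn : i \in (`](- n.+1%:Z), 0] : interval int).
  rewrite in_itv /= (itvP hi) andbT ltrNl.
  have : (`|i| < n)%N by near: n; exact: nbhs_infty_gt.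
  by move/ltnW; rewrite -ltnS -ltz_nat abszE ler0_norm // (itvP hi).
have := congr1 (fun f => f (exist _ i hn)) (ux n).
by rewrite /subblock /= (bool_irrelevance (subset_past _ _ _) hi).
Unshelve. all: by end_near.
Qed.

Lemma concat_subblock {Sigma : finType} (k : nat) (x : block Sigma `]-oo, 0])
    (h : {subset `]-oo, (- k%:Z)] <= (`]-oo, 0] : interval int)}) :
  concat (subblock h x) (subblock (subset_past k) x) = x.
Proof.
apply: funext => i; have [hk|hk] := boolP (val i \in `]-oo, (- k%:Z)]).
  by rewrite (concat_inl _ _ hk); congr x; exact: val_inj.
by rewrite (concat_inr _ _ hk); congr x; exact: val_inj.
Qed.

Lemma subblock_concat {Sigma : finType} (k : nat)
    (u : block Sigma `]-oo, (- k%:Z)]) (a : block Sigma `](- k%:Z), 0]) :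
  subblock (subset_past k) (concat u a) = a.
Proof.
apply: funext => i; rewrite /subblock.
have hk : val i \notin (`]-oo, (- k%:Z)] : interval int).
  by have := valP i; rewrite !in_itv /= => /andP[/lt_geF ->].
pose j : {i | i \in (`]-oo, 0] : interval int)} :=
  exist _ (val i) (subset_past k _ (valP i)).
rewrite (@concat_inr _ _ _ _ u a j hk).
by congr a; exact: val_inj.
Qed.

Lemma eq_subblock_le {Sigma : finType} {m n : nat}
    {x y : block Sigma `]-oo, 0]} :
  (m <= n)%N ->
  subblock (subset_past n) x = subblock (subset_past n) y ->
  subblock (subset_past m) x = subblock (subset_past m) y.
Proof.
move=> mn xy; apply: funext => i; rewrite /subblock.
have hn : val i \in (`](- n%:Z), 0] : interval int).
  have := valP i; rewrite !in_itv /= => /andP[mi ->]; rewrite andbT.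
  by apply: le_lt_trans mi; rewrite lerN2 lez_nat.
have := congr1 (fun f => f (exist _ (val i) hn)) xy.
rewrite /subblock /=.
by rewrite (bool_irrelevance (subset_past n _ _) (subset_past m _ (valP i))).
Qed.

(** * Comparison of [omega1p] with [Gamma1p] *)

(** The far past of [x] is itself one of the left extensions over which [omega1p] quantifies. *)
Lemma omega1p_Gamma1p {Sigma : finType} {X : set (bisequence Sigma)} {k : nat}
    {x : block Sigma `]-oo, 0]} {sigma : Sigma} :
  blocks X `]-oo, 0] x -> omega1p X (subblock (subset_past k) x) sigma ->
  Gamma1p X x sigma.
Proof.
move=> Xx wx.
have h : {subset `]-oo, (- k%:Z)] <= (`]-oo, 0] : interval int)}.
  by apply: subset_itv => //; rewrite bnd_simp oppr_le0.
have := wx (subblock h x); rewrite concat_subblock; apply; split;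
  last by rewrite concat_subblock.
by case: Xx => z Xz <-; exists z.
Qed.

(** A left extension that refuses [sigma], glued to the recent past of [x], is the required [y];
    letting [k] grow gives pasts converging to [x]. *)
Lemma not_omega1p {Sigma : finType} {X : set (bisequence Sigma)} {k : nat}
    {x : block Sigma `]-oo, 0]} {sigma : Sigma} :
  ~ omega1p X (subblock (subset_past k) x) sigma ->
  exists y, [/\ blocks X `]-oo, 0] y,
    subblock (subset_past k) y = subblock (subset_past k) x &
    ~ Gamma1p X y sigma].
Proof.
move=> /existsNP[u /not_implyP[[_ Xu] nu]].
by exists (concat u (subblock (subset_past k) x)); rewrite subblock_concat.
Qed.

(** * From a g-function to property g *)

Section from_g_function.
Context {R : realType} {Sigma : finType} (X : set (bisequence Sigma)).
Context (cX : closed X).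
Context (g : block Sigma `]-oo, 0] * discrete_topology Sigma -> R).
Context (gX : g_function X g).

(** If [beta] is not allowed after [x], closedness of [Gamma1p] forbids it after [u n] for large
    [n]; otherwise continuity of [g] within [gdom X] gives the bound. *)
Lemma near_g_function (u : nat -> block Sigma `]-oo, 0]) x e beta :
  blocks X `]-oo, 0] x -> (forall n, blocks X `]-oo, 0] (u n)) ->
  u @ \oo --> x -> 0 < e ->
  \forall n \near \oo, Gamma1p X (u n) beta ->
    Gamma1p X x beta /\ g (u n, beta) <= g (x, beta) + e.
Proof.
move=> Xx Xu ux e0; have [Gx|nGx] := pselect (Gamma1p X x beta); last first.
  have oG : open (~` [set y | Gamma1p X y beta]).
    exact: closed_openC (Gamma1p_closed X beta cX).
  have nC : nbhs x (~` [set y | Gamma1p X y beta]) by exact: open_nbhs_nbhs.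
  have uC : \forall n \near \oo, ~ Gamma1p X (u n) beta := ux _ nC.
  by apply: filterS uC => n nG /nG.
case: gX => /subspace_continuousP/(_ (x, beta)) gc _ _.
have /cvgrPdist_le/(_ e e0) := gc (conj Xx Gx).
rewrite near_withinE => gn.
(* The same symbol, typed as a point of the discrete space so that the pair converges in the product
   topology. *)
pose b : discrete_topology Sigma := beta.
have unx : (u n, b) @[n --> \oo] --> (x, b).
  exact (cvg_pair ux (cvg_cst b)).
have gu : \forall n \near \oo, gdom X (u n, b) ->
  `|g (x, b) - g (u n, b)| <= e := unx _ gn.
apply: filterS gu => n gun Gu; split=> //.
have := gun (conj (Xu n) Gu).
by rewrite distrC ler_distl => /andP[].
Qed.

Lemma g_function_pos_Delta1p x alpha :
  blocks X `]-oo, 0] x -> Gamma1p X x alpha -> 0 < g (x, alpha) ->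
  Delta1p X x alpha.
Proof.
move=> Xx Gx g0; apply: contrapT => nD.
have /choice[u uP] : forall n, exists y, [/\ blocks X `]-oo, 0] y,
    subblock (subset_past n.+1) y = subblock (subset_past n.+1) x &
    ~ Gamma1p X y alpha].
  by move=> n; apply: not_omega1p => wn; apply: nD; exists n.
have ux : u @ \oo --> x by apply: subblock_cvg => n; case: (uP n).
have Xu n : blocks X `]-oo, 0] (u n) by case: (uP n).
(* The error [e] is incurred at most once per symbol; dividing by [#|Sigma|.+1] keeps the total
   strictly below [g (x, alpha)]. *)
pose e := g (x, alpha) / #|Sigma|.+1%:R.
have e0 : 0 < e by rewrite divr_gt0.
have : \forall n \near \oo, forall beta, Gamma1p X (u n) beta ->
    Gamma1p X x beta /\ g (u n, beta) <= g (x, beta) + e.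
  (* The alphabet is finite, so one [n] serves all symbols. *)
  by apply: filter_forall => beta; exact: near_g_function.
move=> /filter_ex[n un].
have [_ gge0 gsum] := gX.
have [_ _ nGu] := uP n.
suff : 1 < 1 :> R by rewrite ltxx.
rewrite -{1}(gsum _ (Xu n)).
apply: (@le_lt_trans _ _
    (\sum_(beta | beta \in Gamma1p X (u n)) g (x, beta) +
     \sum_(beta : Sigma) e)).
  apply: (@le_trans _ _
      (\sum_(beta | beta \in Gamma1p X (u n)) (g (x, beta) + e))).
    by apply: ler_sum => beta; rewrite inE => /un[].
  rewrite big_split lerD2l [leLHS]big_mkcond; apply: ler_sum => beta _.
  by case: ifP => // _; exact: ltW.
(* Splits 1 into [g (x, alpha)], which exceeds the total error, and the sum over the other symbols
   of [Gamma1p X x], which bounds the sum over [Gamma1p X (u n)] since that set omits [alpha]. *)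
have := gsum _ Xx; rewrite (bigD1 alpha) /=; last by rewrite inE.
move=> <-; rewrite addrC ler_ltD//; last first.
  rewrite sumr_const -[e *+ _]mulr_natr /e -mulrA gtr_pMr// mulrC.
  by rewrite ltr_pdivrMr// mul1r ltr_nat.
rewrite [leRHS]big_mkcond [leLHS]big_mkcond; apply: ler_sum => beta _.
case: ifPn => [|_].
  rewrite inE => /[dup] Gub /un[Gb _]; rewrite mem_set//= ifT//.
  by apply: contra_not_neq nGu => <-.
case: ifPn => // /andP[]; rewrite inE => Gb _.
by have /andP[] := gge0 (x, beta) (conj Xx Gb).
Qed.

(** Nonnegative values with sum 1 cannot all vanish, and a charged symbol lies in [Delta1p X x]. *)
Lemma g_function_property_g : property_g X.
Proof.
move=> x Xx; have [_ gge0 gsum] := gX.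
have [alpha Ga g0] : exists2 alpha, Gamma1p X x alpha & 0 < g (x, alpha).
  apply: contrapT => ng; suff : 0 = 1 :> R by move/eqP; rewrite eq_sym oner_eq0.
  rewrite -(gsum x Xx) big1// => alpha; rewrite inE => Ga.
  apply: le_anti; case/andP: (gge0 (x, alpha) (conj Xx Ga)) => -> _.
  by rewrite andbT leNgt; apply/negP => g0; apply: ng; exists alpha.
by exists alpha; exact: g_function_pos_Delta1p.
Qed.

End from_g_function.

(** * Continuity of normalised weights *)

Lemma continuous_dist_le {R : realType} {T : topologicalType} (f : T -> R) :
  (forall x e, 0 < e -> \forall y \near x, `|f x - f y| <= e) -> continuous f.
Proof. by move=> fe x; apply/cvgrPdist_le => e; exact: fe. Qed.

Lemma continuous_normalize {R : realType} {T : topologicalType} {I : finType}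
    (w : T -> I -> R) (i : I) (x : T) :
  (forall j, continuous (w^~ j)) -> \sum_j w x j != 0 ->
  {for x, continuous (fun y => w y i / \sum_j w y j)}.
Proof.
move=> cw w0; apply: cvgM; first exact: cw.
by apply: cvgV => //; apply: (cvg_big add_continuous) => j _; exact: cw.
Qed.

(** The slice at [s] is open in the product, so only continuity along it matters. *)
Lemma continuous_prod_discrete {T U : topologicalType} {S : choiceType}
    (f : T * discrete_topology S -> U) (x : T) (s : S) :
  {for x, continuous (fun y => f (y, s))} -> {for (x, s), continuous f}.
Proof.
move=> fs A /fs fA; exists ([set y | A (f (y, s))], [set s]).
  by split=> //; exact: discrete_set1.
by move=> [y t] [/= fy ->].
Qed.

(** * From property g to a strict g-function *)

Section to_g_function.
Context {R : realType} {Sigma : finType} (X : set (bisequence Sigma)).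

(** [ex_minn] takes a boolean predicate and an existence proof: the former comes from [asbool], the
    latter from [pselect]. *)
Definition delta_weight (x : block Sigma `]-oo, 0]) (sigma : Sigma) : R :=
  if pselect (exists n, `[< omega1p X (subblock (subset_past n.+1) x) sigma >])
  is left wx then (ex_minn wx).+1%:R^-1 else 0.

Lemma delta_weight_ge n x sigma :
  omega1p X (subblock (subset_past n.+1) x) sigma ->
  n.+1%:R^-1 <= delta_weight x sigma.
Proof.
move=> /asboolP wn; rewrite /delta_weight.
case: pselect => [wx|[]]; last by exists n.
by case: ex_minnP => m _ /(_ n wn) mn; rewrite lef_pV2 ?posrE// ler_nat.
Qed.

(** Together with [delta_weight_ge], this is the interface through which the weight is used
    below. *)
Lemma delta_weightP x sigma : delta_weight x sigma = 0 \/
  exists2 n, omega1p X (subblock (subset_past n.+1) x) sigma &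
    delta_weight x sigma = n.+1%:R^-1.
Proof.
rewrite /delta_weight; case: pselect => [wx|]; last by left.
by right; case: ex_minnP => m /asboolP wm _; exists m.
Qed.

Lemma delta_weight_ge0 x sigma : 0 <= delta_weight x sigma.
Proof.
by case: (delta_weightP x sigma) => [->|[n _ ->]]; rewrite ?invr_ge0.
Qed.

Lemma delta_weight_gt0 x sigma : Delta1p X x sigma -> 0 < delta_weight x sigma.
Proof.
by move=> [n _ /delta_weight_ge]; apply: lt_le_trans; rewrite invr_gt0.
Qed.

Lemma delta_weight_notin_Gamma1p x sigma : blocks X `]-oo, 0] x ->
  ~ Gamma1p X x sigma -> delta_weight x sigma = 0.
Proof.
move=> Xx nG; case: (delta_weightP x sigma) => // -[n wn _].
by case: nG; exact: omega1p_Gamma1p wn.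
Qed.

(** A weight [m.+1%:R^-1] at [x] with [m <= n] is witnessed by a word that [y] shares, so [y] weighs
    at least as much; with [m > n] it is at most [n.+1%:R^-1]. *)
Lemma delta_weight_leD n x y sigma :
  subblock (subset_past n.+1) x = subblock (subset_past n.+1) y ->
  delta_weight x sigma <= delta_weight y sigma + n.+1%:R^-1.
Proof.
move=> xy; have y0 := delta_weight_ge0 y sigma.
have [->|[m wm ->]] := delta_weightP x sigma.
  by rewrite addr_ge0// invr_ge0.
have [mn|nm] := leqP m n.
  rewrite (eq_subblock_le _ xy)// in wm.
  by rewrite (le_trans (delta_weight_ge _ _ _ wm))// lerDl invr_ge0.
by rewrite ler_wpDl// lef_pV2 ?posrE// ler_nat ltnW.
Qed.

Lemma delta_weight_continuous sigma : continuous (delta_weight^~ sigma).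
Proof.
apply: continuous_dist_le => x e e0.
have /filter_ex[n ne] := near_infty_natSinv_lt (PosNum e0).
apply: filterS (near_subblock n.+1 x) => y yx.
rewrite ler_distl; apply/andP; split.
  rewrite lerBlDr (le_trans (delta_weight_leD _ _ _ _ yx))// lerD2l.
  exact: ltW.
rewrite (le_trans (delta_weight_leD _ _ _ _ (esym yx)))// lerD2l.
exact: ltW.
Qed.

(** The sum runs over the whole alphabet, so its index set does not vary with the past; on
    admissible pasts the weight vanishes off [Gamma1p], so the total is the same. *)
Definition delta_g (p : block Sigma `]-oo, 0] * discrete_topology Sigma) : R :=
  delta_weight p.1 p.2 / \sum_(sigma : Sigma) delta_weight p.1 sigma.

Context (pX : property_g X).

Lemma sum_delta_weight_gt0 x : blocks X `]-oo, 0] x ->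
  0 < \sum_(sigma : Sigma) delta_weight x sigma.
Proof.
move=> /pX[alpha /delta_weight_gt0 a0]; rewrite (bigD1 alpha)//=.
by rewrite ltr_pwDl// sumr_ge0// => beta _; exact: delta_weight_ge0.
Qed.

Lemma delta_g_continuous p : blocks X `]-oo, 0] p.1 ->
  {for p, continuous delta_g}.
Proof.
case: p => x alpha /= Xx.
apply: continuous_prod_discrete.
apply: (continuous_normalize delta_weight alpha x delta_weight_continuous).
by rewrite gt_eqF// sum_delta_weight_gt0.
Qed.

Lemma delta_g_strict : strict_g_function X delta_g.
Proof.
split; last first.
  move=> x alpha Xx Da.
  by rewrite divr_gt0 ?sum_delta_weight_gt0// delta_weight_gt0.
split=> [|[x alpha] [/= Xx _]|x Xx].
- apply: continuous_in_subspaceT => p /set_mem[Xp _].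
  exact: delta_g_continuous.
- have D0 := sum_delta_weight_gt0 _ Xx.
  rewrite /delta_g /= divr_ge0 ?delta_weight_ge0 ?(ltW D0)//=.
  rewrite ler_pdivrMr// mul1r.
  rewrite (bigD1 alpha)//= lerDl sumr_ge0// => beta _.
  exact: delta_weight_ge0.
- have D0 := sum_delta_weight_gt0 _ Xx.
  rewrite /delta_g /= -mulr_suml -[RHS](divff (lt0r_neq0 D0)); congr (_ / _).
  rewrite big_mkcond /=; apply: eq_bigr => beta _; case: ifPn => //.
  by move=> /negP; rewrite inE => /delta_weight_notin_Gamma1p->.
Qed.

End to_g_function.

Theorem theorem2p4 (R : realType) (Sigma : finType)
  (X : set (bisequence Sigma)) (hX : subshift X) :
  [<-> (exists g : block Sigma `]-oo, 0] * discrete_topology Sigma -> R,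
          g_function X g);
       property_g X;
       (exists g : block Sigma `]-oo, 0] * discrete_topology Sigma -> R,
          strict_g_function X g)].
Proof.
have [cX _] := hX; tfae.
- by move=> [g]; exact: g_function_property_g.
- by move=> pX; exists (delta_g X); exact: delta_g_strict.
- by move=> [g [gX _]]; exists g.
Qed.
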